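(* Let $S$ be a quasi-separative semigroup and let $\Omega\subset S\times S$ be a relation satisfying the following three conditions: (i) $\Omega\cap E(a)=\Omega\cap F(a)$ for all $a\in S$; (ii) $b(\Omega\cap E(ab))\subset\Omega$ for all $a,b\in S$; (iii) $(\Omega\cap F(ab))a\subset\Omega$ for all $a,b\in S$. Then $S/\!\!\sim_{\Omega}$ is a semilattice, where $a\sim_\Omega b \Longleftrightarrow \Omega\cap E(a)=\Omega\cap E(b)$.
   Context: A semigroup $S$ is called quasi-separative if for all $x,y\in S$: $x^2=xy=yx=y^2$ implies $x=y$. For a semigroup $S$ and $a\in S$, put $E(a)=\{(x,y)\in S\times S\mid ax=ay\}$ and $F(a)=\{(x,y)\in S\times S\mid xa=ya\}$. For a binary relation $R\subset S\times S$ and $x\in S$, put $xR=\{(xa,xb)\mid (a,b)\in R\}$ and $Rx=\{(ax,bx)\mid (a,b)\in R\}$. The symbol $\subset$ denotes (not necessarily strict) inclusion. On any semigroup, when $\Omega$ satisfies (i)–(iii), the equivalence $\sim_\Omega$ is a congruence, so $S/\!\!\sim_\Omega$ denotes the quotient semigroup. A semilattice is a commutative idempotent semigroup. *)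

(* Defs.v *)
From HB Require Import structures.
From mathcomp Require Import all_boot.
From mathcomp Require Import boolp classical_sets.

Set Implicit Arguments.
Unset Strict Implicit.
Unset Printing Implicit Defensive.

Local Open Scope classical_set_scope.
Local Open Scope quotient_scope.
Local Open Scope group_scope.

(* The choiceType structure carried by a semigroupType is no restriction:
   classically every type has one (boolp.gen_choiceMixin). *)

Definition quasi_separative (S : semigroupType) : Prop :=
  forall x y : S,
    x * x = x * y -> x * y = y * x -> y * x = y * y -> x = y.

Definition is_semilattice (S : semigroupType) : Prop :=
  commutative (@mul S) /\ idempotent_op (@mul S).

Section Relations.
Variable S : semigroupType.
Implicit Types (a x : S) (R : set (S * S)).

Definition E a : set (S * S) := [set p | a * p.1 = a * p.2].

Definition F a : set (S * S) := [set p | p.1 * a = p.2 * a].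

Definition lmul_rel x R : set (S * S) :=
  [set (x * p.1, x * p.2) | p in R].

Definition rmul_rel R x : set (S * S) :=
  [set (p.1 * x, p.2 * x) | p in R].

Record congruence := Congruence {
  congr_rel :> equiv_rel S;
  congr_mul : forall a a' b b' : S,
    congr_rel a a' -> congr_rel b b' -> congr_rel (a * b) (a' * b') }.

End Relations.

Definition quotient_semigroup (S : semigroupType) (c : congruence S) : Type :=
  {eq_quot c}.

Section Quotient.
Variables (S : semigroupType) (c : congruence S).
Local Notation Q := (quotient_semigroup c).

HB.instance Definition _ := EqQuotient.copy Q {eq_quot c}.
HB.instance Definition _ := Choice.copy Q {eq_quot c}.

Definition quotient_mul (u v : Q) : Q := \pi_Q (repr u * repr v).

Lemma quotient_mul_pi (x y : S) :
  quotient_mul (\pi_Q x) (\pi_Q y) = \pi_Q (x * y).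
Proof. by apply/eqmodP/congr_mul; apply/eqmodP; rewrite reprK. Qed.

Lemma quotient_mulA : associative quotient_mul.
Proof.
elim/quotW=> x; elim/quotW=> y; elim/quotW=> z.
rewrite (quotient_mul_pi y z) (quotient_mul_pi x y).
by rewrite (quotient_mul_pi x (y * z)) (quotient_mul_pi (x * y) z) mulgA.
Qed.

HB.instance Definition _ := isSemigroup.Build Q quotient_mulA.

End Quotient.

Section Sim.
Variables (S : semigroupType) (Omega : set (S * S)).

Definition sim (a b : S) : Prop := Omega `&` E a = Omega `&` E b.

Definition simb : rel S := fun a b => `[< sim a b >].

Lemma simb_equiv : equiv_class_of simb.
Proof.
split=> [a|a b|b a d].
- by apply/asboolP.
- by apply/asboolP/asboolP; rewrite /sim => ->.
- by move=> /asboolP ab /asboolP bd; apply/asboolP; rewrite /sim ab.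
Qed.

Hypothesis EF : forall a : S, Omega `&` E a = Omega `&` F a.
Hypothesis lE : forall a b : S, lmul_rel b (Omega `&` E (a * b)) `<=` Omega.
Hypothesis rF : forall a b : S, rmul_rel (Omega `&` F (a * b)) a `<=` Omega.

Let simP a b : sim a b ->
  forall p : S * S, Omega p -> a * p.1 = a * p.2 -> b * p.1 = b * p.2.
Proof. by move=> ab p Op pa; have [] : (Omega `&` E b) p by rewrite -ab. Qed.

Let toF a (p : S * S) : Omega p -> a * p.1 = a * p.2 -> p.1 * a = p.2 * a.
Proof. by move=> Op pa; have [] : (Omega `&` F a) p by rewrite -EF. Qed.

Let toE a (p : S * S) : Omega p -> p.1 * a = p.2 * a -> a * p.1 = a * p.2.
Proof. by move=> Op pa; have [] : (Omega `&` E a) p by rewrite EF. Qed.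

Let simMr a b d : sim a b -> sim (a * d) (b * d).
Proof.
suff sub a' b' : sim a' b' ->
    Omega `&` E (a' * d) `<=` Omega `&` E (b' * d).
  by move=> ab; apply/seteqP; split; apply: sub.
move=> ab p [Op pad]; split=> //.
have Odp : Omega (d * p.1, d * p.2) by apply: (lE (a := a') (b := d)); exists p.
have := simP ab Odp; rewrite /E /= !mulgA; exact.
Qed.

Let simMl a b d : sim a b -> sim (d * a) (d * b).
Proof.
suff sub a' b' : sim a' b' ->
    Omega `&` E (d * a') `<=` Omega `&` E (d * b').
  by move=> ab; apply/seteqP; split; apply: sub.
move=> ab p [Op pda]; split=> //.
have pF := toF Op pda.
have Opd : Omega (p.1 * d, p.2 * d) by apply: (rF (a := d) (b := a')); exists p.
apply: toE => //; rewrite !mulgA.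
apply: (toF (p := (_, _)) Opd); apply: (simP ab Opd).
by apply: (toE Opd); rewrite /= -!mulgA.
Qed.

Lemma simb_mul (a a' b b' : S) :
  simb a a' -> simb b b' -> simb (a * b) (a' * b').
Proof.
move=> /asboolP aa' /asboolP bb'; apply/asboolP.
exact: etrans (simMr b aa') (simMl a' bb').
Qed.

Definition sim_congruence : congruence S :=
  @Congruence S (EquivRelPack simb_equiv) simb_mul.

End Sim.

(* Main.v *)
Require Import Defs.
From HB Require Import structures.
From mathcomp Require Import all_boot.
From mathcomp Require Import boolp classical_sets.

Local Open Scope classical_set_scope.
Local Open Scope group_scope.

(** Fix a pair [p = (x, y)] of [Omega] and let [I] be the set of all [a] with
    [a * x = a * y].  Two elements are equivalent exactly when they belong to
    the same sets [I], so the quotient is a semilattice as soon as every [I]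
    satisfies [a * a \in I <-> a \in I] and [a * b \in I <-> b * a \in I].

    Condition (i) lets one multiply on either side, so [I] is a two-sided
    ideal ([E_mull], [E_mulr]).  The heart of the proof is that [I] is
    semiprime ([E_sqr]): this is where quasi-separativity is applied, to the
    elements [a * x] and [a * y].  Commutativity is then formal: if
    [a * b \in I] then [(b * a) * (b * a) = b * (a * b) * a] is in the ideal
    [I], hence so is [b * a]. *)

Section EqualizerIdeal.
Variables (S : semigroupType) (Omega : set (S * S)).
Implicit Types (a b : S) (p : S * S).
Hypothesis EF : forall a, Omega `&` E a = Omega `&` F a.

Lemma E_iff_F a p : Omega p -> E a p <-> F a p.
Proof.
move=> Op; split=> ap.
- by have [] : (Omega `&` F a) p by rewrite -EF.
- by have [] : (Omega `&` E a) p by rewrite EF.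
Qed.

Lemma E_mull a b p : E a p -> E (b * a) p.
Proof. by rewrite /E /= -!mulgA => ->. Qed.

(** Right multiplication is harmless on the [F] side, and membership in
    [Omega] allows passing to that side and back. *)
Lemma E_mulr a b p : Omega p -> E a p -> E (a * b) p.
Proof.
move=> Op /(E_iff_F a _ Op) ap; apply/(E_iff_F _ _ Op).
by rewrite /F /= !mulgA ap.
Qed.

Hypothesis lE : forall a b, lmul_rel b (Omega `&` E (a * b)) `<=` Omega.
Hypothesis qsS : quasi_separative S.

(** Put [u = a * x] and [v = a * y].  If [a * a] equalizes [x] and [y], then
    condition (ii) puts [(u, v)] in [Omega], where [a] equalizes it on the
    left, hence on the right.  As [u] and [v] are left multiples of [a], they
    equalize [(u, v)] on both sides, so that the four products of [u] and [v]
    coincide. *)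
Lemma E_sqr a p : Omega p -> E (a * a) p -> E a p.
Proof.
move=> Op aap; set u := a * p.1; set v := a * p.2.
have Ouv : Omega (u, v) by apply: (lE a a); exists p.
have auv : E a (u, v) by rewrite /E /= !mulgA.
have azuv z : E (a * z) (u, v) by exact: E_mulr.
have uvaz z : F (a * z) (u, v) by apply/(E_iff_F _ _ Ouv).
have uu_uv : u * u = u * v := azuv p.1.
have uu_vu : u * u = v * u := uvaz p.1.
have vu_vv : v * u = v * v := azuv p.2.
by apply: qsS; rewrite // -uu_uv.
Qed.

Lemma E_mulC a b p : Omega p -> E (a * b) p -> E (b * a) p.
Proof.
move=> Op abp; apply: E_sqr => //.
have -> : (b * a) * (b * a) = b * (a * b) * a by rewrite !mulgA.
exact/E_mulr/E_mull.
Qed.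

End EqualizerIdeal.

Theorem theorem2 (S : semigroupType) (Omega : set (S * S))
    (qsS : quasi_separative S)
    (EF : forall a : S, Omega `&` E a = Omega `&` F a)
    (lE : forall a b : S, lmul_rel b (Omega `&` E (a * b)) `<=` Omega)
    (rF : forall a b : S, rmul_rel (Omega `&` F (a * b)) a `<=` Omega) :
  is_semilattice (quotient_semigroup (sim_congruence EF lE rF)).
Proof.
split.
- elim/quotW=> a; elim/quotW=> b.
  rewrite /mul /= !quotient_mul_pi; apply/eqmodP/asboolP/seteqP.
  by split=> p [Op abp]; split=> //; apply: (E_mulC _ _ EF lE qsS).
- elim/quotW=> a.
  rewrite /mul /= quotient_mul_pi; apply/eqmodP/asboolP/seteqP.
  split=> p [Op ap]; split=> //; last exact: E_mull.
  exact: (E_sqr _ _ EF lE qsS).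
Qed.
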